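(* Let $G$ be a connected complex semi-simple Lie group with Lie algebra $\mathfrak{g}$, let $q\in\mathbb{C}\setminus\{0\}$ be not a root of unity, and let $l^\pm:\mathbb{C}_q[G]\to U_q(\mathfrak{g})$ be the l-functional maps on the coordinate algebra $\mathbb{C}_q[G]$. For every matrix coefficient $c^\lambda_{-\mu,\nu}\in\mathbb{C}_q[G]$ there are elements $f^+(c^\lambda_{-\mu,\nu})\in U_q^{\nu-\mu}(\mathfrak{n}_+)$ and $f^-(c^\lambda_{-\mu,\nu})\in U_q^{\nu-\mu}(\mathfrak{n}_-)$ such that $$l^+(c^\lambda_{-\mu,\nu})=f^+(c^\lambda_{-\mu,\nu})\,K_\mu,\qquad l^-(c^\lambda_{-\mu,\nu})=f^-(c^\lambda_{-\mu,\nu})\,K_{-\nu}.$$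
   Context: **Quantum group data.** $\{\alpha_i\}_{i=1,\dots,N}$ are the simple roots of $\mathfrak{g}$, $\mathbf{Q}=\sum_i\mathbb{Z}\alpha_i$ is the root lattice, and $\mathbf{L}\supseteq\mathbf{Q}$ is the character group of a maximal torus of $G$, viewed as a sublattice of the weight lattice. $\langle\cdot,\cdot\rangle$ is the scalar product on $\mathbf{L}$ with $\langle\alpha_i,\alpha_j\rangle=d_ia_{ij}$, where $(a_{ij})$ is the Cartan matrix and $(d_ia_{ij})$ the symmetrized Cartan matrix. Put $q_i=q^{d_i}$. A root of $q$ is fixed so that $q^{\langle\lambda,\mu\rangle}$ makes sense (multiplicatively) for all $\lambda,\mu\in\mathbf{L}$. $U_q(\mathfrak{g})$ is the Hopf algebra over $\mathbb{C}$ with generators $K_\lambda$ ($\lambda\in\mathbf{L}$), $E_i,F_i$ ($1\le i\le N$) and relations $K_0=1$, $K_\lambda K_\mu=K_{\lambda+\mu}$, $K_\lambda E_iK_\lambda^{-1}=q^{\langle\lambda,\alpha_i\rangle}E_i$, $K_\lambda F_iK_\lambda^{-1}=q^{-\langle\lambda,\alpha_i\rangle}F_i$, $[E_i,F_j]=\delta_{ij}\frac{K_i-K_i^{-1}}{q_i-q_i^{-1}}$ with $K_i:=K_{\alpha_i}$, and the $q$-Serre relations $\sum_{r=0}^{1-a_{ij}}(-1)^r\binom{1-a_{ij}}{r}_{q_i}E_i^{1-a_{ij}-r}E_jE_i^r=0$ for $i\ne j$, and the same with $F$ instead of $E$ (symmetric $q_i$-binomial coefficients). The coproduct is $\Delta(K_\lambda)=K_\lambda\otimes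 K_\lambda$, $\Delta(E_i)=E_i\otimes K_i+1\otimes E_i$, $\Delta(F_i)=F_i\otimes1+K_i^{-1}\otimes F_i$; the counit satisfies $\varepsilon(K_\lambda)=1$, $\varepsilon(E_i)=\varepsilon(F_i)=0$; the antipode satisfies $S(K_\lambda)=K_\lambda^{-1}$, $S(E_i)=-E_iK_i^{-1}$, $S(F_i)=-K_iF_i$. $U_q(\mathfrak{n}_+)$, $U_q(\mathfrak{n}_-)$ are the subalgebras generated by the $E_i$, resp. the $F_i$, and for $\lambda\in\mathbf{Q}$ we set $U_q^\lambda(\mathfrak{n}_\pm)=\{f\in U_q(\mathfrak{n}_\pm): K_\mu fK_\mu^{-1}=q^{\langle\lambda,\mu\rangle}f\ \forall\mu\in\mathbf{L}\}$. $\mathbb{C}_q[G]$ is the Hopf subalgebra of the Hopf dual $U_q(\mathfrak{g})^\circ$ spanned by the matrix coefficients $c_{u,v}(f)=u(fv)$, where $v$ is a vector in the irreducible representation $V_\lambda$ of $U_q(\mathfrak{g})$ with highest weight $\lambda\in\mathbf{L}$ dominant ($K_\mu$ acts on weight vectors of weight $\nu$ by $q^{\langle\mu,\nu\rangle}$), and $u\in V_\lambda^*$. If $u\in V_\lambda^*$ and $v\in V_\lambda$ are weight vectors of weights $-\mu$ and $\nu$ (in the dual representation, resp. in $V_\lambda$; so $u$ vanishes on all weight spaces of $V_\lambda$ except that of weight $\mu$), then $c_{u,v}$ is also denoted $c^\lambda_{-\mu,\nu}$. The universal r-form $r$ on $\mathbb{C}_q[G]$ is $r(c_{u,v}\otimes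 c_{u',v'})=(u\otimes u')(R(v\otimes v'))$, where on a tensor product of two such representations $R=D\circ\Theta$, $D$ acts on the tensor product of the weight spaces of weights $\nu,\nu'$ by $q^{\langle\nu,\nu'\rangle}$, and $\Theta=\sum_\gamma\Theta_\gamma$ ($\gamma$ running over $\sum_i\mathbb{N}_0\alpha_i$) with $\Theta_0=1\otimes1$, $\Theta_\gamma\in U_q^\gamma(\mathfrak{n}_+)\otimes U_q^{-\gamma}(\mathfrak{n}_-)$ is the unique family such that $R\,\Delta(f)=\Delta^{\mathrm{op}}(f)\,R$ for all $f\in U_q(\mathfrak{g})$. **l-functionals.** With $\bar r$ the convolution inverse of $r$, $l^+(a)=r(\cdot\otimes a)$ and $l^-(a)=\bar r(a\otimes\cdot)$ for $a\in\mathbb{C}_q[G]$. These functionals on $\mathbb{C}_q[G]$ are identified with elements of $U_q(\mathfrak{g})$, where $f\in U_q(\mathfrak{g})$ is regarded as the functional $c\mapsto c(f)$ on $\mathbb{C}_q[G]$ (it is known that the Hopf algebra generated by all $l^\pm(a)$ equals $U_q(\mathfrak{g})$ in this sense). *)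

(* Defs.v *)
From HB Require Import structures.
From mathcomp Require Import all_boot all_order all_algebra.
From mathcomp Require Import boolp classical_sets functions fsbigop reals.
From mathcomp Require Import complex mxtens.

Set Implicit Arguments.
Unset Strict Implicit.
Unset Printing Implicit Defensive.

Import Order.TTheory GRing.Theory Num.Theory.
Local Open Scope quotient_scope.
Local Open Scope ring_scope.

(** * Associative algebras presented by generators and relations

   The algebra presented by generators and relations over [K] is the set of
   formal expressions modulo the least congruence containing the relations
   and the axioms of unital associative [K]-algebras. *)

Inductive term (K G : Type) : Type :=
| TGen of G
| TCst of K
| TAdd of term K G & term K G
| TMul of term K G & term K G.
Arguments TGen {K G}.
Arguments TCst {K G}.

HB.instance Definition _ (K G : Type) := gen_eqMixin (term K G).
HB.instance Definition _ (K G : Type) := gen_choiceMixin (term K G).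

Fixpoint teval (K G : Type) (B : pzRingType) (c : K -> B) (g : G -> B)
    (t : term K G) : B :=
  match t with
  | TGen x => g x
  | TCst a => c a
  | TAdd s1 s2 => teval c g s1 + teval c g s2
  | TMul s1 s2 => teval c g s1 * teval c g s2
  end.

Definition TScale (K G : Type) (a : K) (t : term K G) := TMul (TCst a) t.
Definition TExp (K : fieldType) (G : Type) (t : term K G) (n : nat) :=
  iter n (TMul t) (TCst 1).
Definition TSub (K : fieldType) (G : Type) (s t : term K G) :=
  TAdd s (TScale (-1) t).

(* The field [paug] is a character of the presented algebra; it serves only
   to make that algebra nonzero, as required by [algType]. *)
Record presentation (K : fieldType) := Presentation {
  pgen : Type;
  prel : term K pgen -> term K pgen -> Prop;
  paug : pgen -> K;
  paugP : forall s t, prel s t -> teval id paug s = teval id paug t }.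

Section PresentedAlgebra.
Variables (K : fieldType) (P : presentation K).
Local Notation term := (term K (pgen P)).

Inductive peq : term -> term -> Prop :=
| peq_rel s t : prel s t -> peq s t
| peq_refl t : peq t t
| peq_sym s t : peq s t -> peq t s
| peq_trans s t u : peq s t -> peq t u -> peq s u
| peq_add s s' t t' : peq s s' -> peq t t' -> peq (TAdd s t) (TAdd s' t')
| peq_mul s s' t t' : peq s s' -> peq t t' -> peq (TMul s t) (TMul s' t')
| peq_addA s t u : peq (TAdd s (TAdd t u)) (TAdd (TAdd s t) u)
| peq_addC s t : peq (TAdd s t) (TAdd t s)
| peq_add0 t : peq (TAdd (TCst 0) t) t
| peq_addN t : peq (TAdd (TScale (-1) t) t) (TCst 0)
| peq_mulA s t u : peq (TMul s (TMul t u)) (TMul (TMul s t) u)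
| peq_mul1 t : peq (TMul (TCst 1) t) t
| peq_mulDl s t u : peq (TMul (TAdd s t) u) (TAdd (TMul s u) (TMul t u))
| peq_mulDr s t u : peq (TMul s (TAdd t u)) (TAdd (TMul s t) (TMul s u))
| peq_cstD a b : peq (TCst (a + b)) (TAdd (TCst a) (TCst b))
| peq_cstM a b : peq (TCst (a * b)) (TMul (TCst a) (TCst b))
| peq_cstC a t : peq (TMul t (TCst a)) (TMul (TCst a) t).

Let peqb (s t : term) : bool := `[< peq s t >].
Fact peqb_refl : reflexive peqb. Proof. by move=> t; apply/asboolP/peq_refl. Qed.
Fact peqb_sym : symmetric peqb.
Proof. by move=> s t; apply/asboolP/asboolP; apply: peq_sym. Qed.
Fact peqb_trans : transitive peqb.
Proof.
by move=> t s u /asboolP st /asboolP tu; apply/asboolP/(peq_trans st tu).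
Qed.
Canonical peqb_equiv := EquivRel peqb peqb_refl peqb_sym peqb_trans.

Definition palg := {eq_quot peqb_equiv}.
HB.instance Definition _ := Choice.on palg.
HB.instance Definition _ := EqQuotient.on palg.

Definition pclass (t : term) : palg := \pi_palg t.

Lemma pclassP s t : pclass s = pclass t <-> peq s t.
Proof. by split=> [/eqmodP/asboolP|h]; [|apply/eqmodP/asboolP]. Qed.

Lemma pclassW (Q : palg -> Prop) : (forall t, Q (pclass t)) -> forall x, Q x.
Proof. by move=> h; apply: quotW. Qed.

Lemma peq_repr t : peq (repr (pclass t)) t.
Proof. by apply/pclassP; rewrite /pclass reprK. Qed.

Definition padd (x y : palg) := pclass (TAdd (repr x) (repr y)).
Definition pmul (x y : palg) := pclass (TMul (repr x) (repr y)).
Definition pscale (a : K) (x : palg) := pclass (TScale a (repr x)).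

Lemma paddE s t : padd (pclass s) (pclass t) = pclass (TAdd s t).
Proof. by apply/pclassP; apply: peq_add; apply: peq_repr. Qed.
Lemma pmulE s t : pmul (pclass s) (pclass t) = pclass (TMul s t).
Proof. by apply/pclassP; apply: peq_mul; apply: peq_repr. Qed.
Lemma pscaleE a t : pscale a (pclass t) = pclass (TScale a t).
Proof. by apply/pclassP; apply: peq_mul; [apply: peq_refl|apply: peq_repr]. Qed.

Fact paddA : associative padd.
Proof.
elim/pclassW=> s; elim/pclassW=> t; elim/pclassW=> u; rewrite !paddE.
by apply/pclassP/peq_addA.
Qed.
Fact paddC : commutative padd.
Proof.
by elim/pclassW=> s; elim/pclassW=> t; rewrite !paddE; apply/pclassP/peq_addC.
Qed.
Fact padd0 : left_id (pclass (TCst 0)) padd.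
Proof. by elim/pclassW=> t; rewrite paddE; apply/pclassP/peq_add0. Qed.
Fact paddN : left_inverse (pclass (TCst 0)) (pscale (-1)) padd.
Proof. by elim/pclassW=> t; rewrite pscaleE paddE; apply/pclassP/peq_addN. Qed.

HB.instance Definition _ :=
  GRing.isZmodule.Build palg paddA paddC padd0 paddN.

Fact pmulA : associative pmul.
Proof.
elim/pclassW=> s; elim/pclassW=> t; elim/pclassW=> u; rewrite !pmulE.
by apply/pclassP/peq_mulA.
Qed.
Fact pmul1 : left_id (pclass (TCst 1)) pmul.
Proof. by elim/pclassW=> t; rewrite pmulE; apply/pclassP/peq_mul1. Qed.
Fact pmulr1 : right_id (pclass (TCst 1)) pmul.
Proof.
elim/pclassW=> t; rewrite pmulE; apply/pclassP.
by apply: peq_trans (peq_cstC _ _) _; apply: peq_mul1.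
Qed.
Fact pmulDl : left_distributive pmul padd.
Proof.
elim/pclassW=> s; elim/pclassW=> t; elim/pclassW=> u.
by rewrite !(pmulE, paddE); apply/pclassP/peq_mulDl.
Qed.
Fact pmulDr : right_distributive pmul padd.
Proof.
elim/pclassW=> s; elim/pclassW=> t; elim/pclassW=> u.
by rewrite !(pmulE, paddE); apply/pclassP/peq_mulDr.
Qed.
Lemma peq_paug s t : peq s t -> teval id (paug (p:=P)) s = teval id (paug (p:=P)) t.
Proof.
elim=> //=.
- by move=> *; apply: paugP.
- by move=> ? ? ? _ -> _ ->.
- by move=> ? ? ? ? _ -> _ ->.
- by move=> ? ? ? ? _ -> _ ->.
- by move=> *; rewrite addrA.
- by move=> *; rewrite addrC.
- by move=> *; rewrite add0r.
- by move=> *; rewrite mulN1r addNr.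
- by move=> *; rewrite mulrA.
- by move=> *; rewrite mul1r.
- by move=> *; rewrite mulrDl.
- by move=> *; rewrite mulrDr.
- by move=> *; rewrite mulrC.
Qed.
Fact pone_neq0 : pclass (TCst 1) != pclass (TCst 0).
Proof.
by apply/eqP=> /pclassP/peq_paug/= /eqP; rewrite oner_eq0.
Qed.

HB.instance Definition _ := GRing.Zmodule_isNzRing.Build palg
  pmulA pmul1 pmulr1 pmulDl pmulDr pone_neq0.

Fact pscaleA a b x : pscale a (pscale b x) = pscale (a * b) x.
Proof.
elim/pclassW: x => t; rewrite !pscaleE; apply/pclassP.
apply: peq_trans (peq_mulA _ _ _) _.
by apply: peq_mul (peq_refl _); apply/peq_sym/peq_cstM.
Qed.
Fact pscale1 : left_id 1 pscale.
Proof. by elim/pclassW=> t; rewrite pscaleE; apply/pclassP/peq_mul1. Qed.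
Fact pscaleDr : right_distributive pscale +%R.
Proof.
move=> a; elim/pclassW=> s; elim/pclassW=> t.
rewrite /GRing.add /= !(pscaleE, paddE).
by apply/pclassP/peq_mulDr.
Qed.
Fact pscaleDl x : {morph pscale^~ x : a b / a + b}.
Proof.
move=> a b; elim/pclassW: x => t; rewrite /GRing.add /= !(pscaleE, paddE).
apply/pclassP; apply: peq_trans (peq_mulDl _ _ _).
by apply: peq_mul (peq_refl _); apply: peq_cstD.
Qed.

HB.instance Definition _ := GRing.Zmodule_isLmodule.Build K palg
  pscaleA pscale1 pscaleDr pscaleDl.

Fact pscaleAl (a : K) (x y : palg) : a *: (x * y) = (a *: x) * y.
Proof.
elim/pclassW: x => s; elim/pclassW: y => t.
rewrite /GRing.scale /GRing.mul /= !(pscaleE, pmulE).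
by apply/pclassP; apply: peq_mulA.
Qed.
HB.instance Definition _ := GRing.Lmodule_isLalgebra.Build K palg pscaleAl.

Fact pscaleAr (a : K) (x y : palg) : a *: (x * y) = x * (a *: y).
Proof.
elim/pclassW: x => s; elim/pclassW: y => t.
rewrite /GRing.scale /GRing.mul /= !(pscaleE, pmulE).
apply/pclassP; apply: peq_trans (peq_mulA _ _ _) _.
apply: peq_trans (peq_sym (peq_mulA _ _ _)).
by apply: peq_mul (peq_refl _); apply/peq_sym/peq_cstC.
Qed.
HB.instance Definition _ := GRing.Lalgebra_isAlgebra.Build K palg pscaleAr.

Definition pgenerator (g : pgen P) : palg := pclass (TGen g).

(* The morphism to [B] extending [g] (and [c] on the scalars): by [pliftE] it
   is given by evaluation when the relations hold in [B]. *)
Definition plift (B : pzRingType) (c : K -> B) (g : pgen P -> B) (x : palg) : B :=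
  teval c g (repr x).

Lemma pliftE (B : pzRingType) (c : {rmorphism K -> B}) (g : pgen P -> B) :
    (forall s t, prel s t -> teval c g s = teval c g t) ->
    (forall a b, c a * b = b * c a) ->
  forall t, plift c g (pclass t) = teval c g t.
Proof.
move=> grel cC t.
suff eqt s' t' : peq s' t' -> teval c g s' = teval c g t' by apply/eqt/peq_repr.
elim=> //=.
- by move=> ? ? ? _ -> _ ->.
- by move=> ? ? ? ? _ -> _ ->.
- by move=> ? ? ? ? _ -> _ ->.
- by move=> *; rewrite addrA.
- by move=> *; rewrite addrC.
- by move=> *; rewrite rmorph0 add0r.
- by move=> *; rewrite rmorphN1 rmorph0 mulN1r addNr.
- by move=> *; rewrite mulrA.
- by move=> *; rewrite rmorph1 mul1r.
- by move=> *; rewrite mulrDl.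
- by move=> *; rewrite mulrDr.
- by move=> *; rewrite rmorphD.
- by move=> *; rewrite rmorphM.
Qed.

Section LiftMorphism.
Variables (B : pzRingType) (c : {rmorphism K -> B}) (g : pgen P -> B).
Hypothesis grel : forall s t, prel s t -> teval c g s = teval c g t.
Hypothesis cC : forall a b, c a * b = b * c a.

Lemma plift_gen x : plift c g (pgenerator x) = g x.
Proof. exact: pliftE. Qed.
Lemma pliftP a x y : plift c g (a *: x + y) = c a * plift c g x + plift c g y.
Proof.
elim/pclassW: x => s; elim/pclassW: y => t.
have -> : a *: pclass s + pclass t = pclass (TAdd (TScale a s) t) :> palg.
  by rewrite -paddE -pscaleE.
by rewrite !pliftE.
Qed.
Lemma pliftM x y : plift c g (x * y) = plift c g x * plift c g y.
Proof.
elim/pclassW: x => s; elim/pclassW: y => t.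
have -> : pclass s * pclass t = pclass (TMul s t) :> palg by rewrite -pmulE.
by rewrite !pliftE.
Qed.
Lemma plift1 : plift c g 1 = 1.
Proof. by rewrite [LHS](pliftE grel cC (TCst 1)) /= rmorph1. Qed.
End LiftMorphism.

Lemma peq_alg (a : K) : pclass (TCst a) = a%:A :> palg.
Proof.
rewrite /GRing.scale /GRing.one /= pscaleE; apply/pclassP/peq_sym.
by apply: peq_trans (peq_cstC _ _) _; apply: peq_mul1.
Qed.

Lemma pclassE (t : term) : pclass t = teval (fun a : K => a%:A) pgenerator t.
Proof.
elim: t => [g|a|s IHs t IHt|s IHs t IHt] //=; first exact: peq_alg.
- by rewrite -IHs -IHt; exact: esym (paddE _ _).
- by rewrite -IHs -IHt; exact: esym (pmulE _ _).
Qed.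

Definition pcounit : palg -> K := plift id (paug (p:=P)).

End PresentedAlgebra.

Lemma pcounitE (K : fieldType) (P : presentation K) t :
  pcounit (pclass t : palg P) = teval id (paug (p:=P)) t.
Proof.
by apply: (pliftE (c := idfun)) => [s u|a b]; [apply: paugP|rewrite mulrC].
Qed.

(** * Tensor product of two presented algebras

   [A (x) B] is generated by the symbols [a (x) b], which are bilinear in
   [(a, b)] and multiply componentwise. *)

Section TensorAlgebra.
Variables (K : fieldType) (P Q : presentation K).

Inductive tens_rel :
  term K (palg P * palg Q) -> term K (palg P * palg Q) -> Prop :=
| TensLinl (z : K) a a' b : tens_rel (TGen (z *: a + a', b))
    (TAdd (TScale z (TGen (a, b))) (TGen (a', b)))
| TensLinr (z : K) a b b' : tens_rel (TGen (a, z *: b + b'))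
    (TAdd (TScale z (TGen (a, b))) (TGen (a, b')))
| TensMul a a' b b' :
    tens_rel (TMul (TGen (a, b)) (TGen (a', b'))) (TGen (a * a', b * b'))
| TensOne : tens_rel (TGen (1, 1)) (TCst 1).

Lemma pcounitP (P0 : presentation K) (z : K) (x y : palg P0) :
  pcounit (z *: x + y) = z * pcounit x + pcounit y.
Proof.
elim/pclassW: x => s; elim/pclassW: y => t.
have -> : z *: pclass s + pclass t = pclass (TAdd (TScale z s) t) :> palg P0.
  by rewrite -paddE -pscaleE.
by rewrite !pcounitE.
Qed.
Lemma pcounitM (P0 : presentation K) (x y : palg P0) :
  pcounit (x * y) = pcounit x * pcounit y.
Proof.
elim/pclassW: x => s; elim/pclassW: y => t.
have -> : pclass s * pclass t = pclass (TMul s t) :> palg P0 by rewrite -pmulE.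
by rewrite !pcounitE.
Qed.
Lemma pcounit1 (P0 : presentation K) : pcounit (1 : palg P0) = 1.
Proof. exact: pcounitE. Qed.

Fact tens_augP s t (g := fun p : palg P * palg Q => pcounit p.1 * pcounit p.2) :
  tens_rel s t -> teval id g s = teval id g t.
Proof.
case=> /= *; rewrite /g /= ?pcounitP ?pcounitM ?pcounit1 ?mulr1 //.
- by rewrite mulrDl mulrA.
- by rewrite mulrDr mulrCA.
- by rewrite mulrACA.
Qed.

Definition tens_pres := Presentation tens_augP.
Definition tens := palg tens_pres.
Definition ptens (a : palg P) (b : palg Q) : tens :=
  pgenerator (P := tens_pres) (a, b).

End TensorAlgebra.


Section TensorTheory.
Variables (K : fieldType) (P Q : presentation K).

Lemma ptensPl z a a' b :
  ptens (z *: a + a') b = z *: ptens a b + ptens a' b :> tens P Q.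
Proof.
have /pclassP/= := peq_rel (TensLinl z a a' b : prel (p := tens_pres P Q) _ _).
by rewrite -paddE -pscaleE.
Qed.
Lemma ptensPr z a b b' :
  ptens a (z *: b + b') = z *: ptens a b + ptens a b' :> tens P Q.
Proof.
have /pclassP/= := peq_rel (TensLinr z a b b' : prel (p := tens_pres P Q) _ _).
by rewrite -paddE -pscaleE.
Qed.
Lemma ptensM a a' b b' :
  ptens a b * ptens a' b' = ptens (a * a') (b * b') :> tens P Q.
Proof.
have /pclassP/= := peq_rel (TensMul a a' b b' : prel (p := tens_pres P Q) _ _).
by rewrite -pmulE.
Qed.
Lemma ptens1 : ptens 1 1 = 1 :> tens P Q.
Proof.
by have /pclassP := peq_rel (TensOne P Q : prel (p := tens_pres P Q) _ _).
Qed.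

Definition tens_flip : tens P Q -> tens Q P :=
  plift (P := tens_pres P Q) (GRing.in_alg (tens Q P)) (fun p => ptens p.2 p.1).

(* The action of [A (x) B] on the tensor product of an [A]-module and a
   [B]-module, given by matrices. *)
Definition tens_act (m n : nat) (rho : palg P -> 'M[K]_m)
    (sigma : palg Q -> 'M[K]_n) : tens P Q -> 'M[K]_(m * n) :=
  plift (P := tens_pres P Q) (@scalar_mx K (m * n))
    (fun p => rho p.1 *t sigma p.2).

End TensorTheory.

Lemma in_algC (K : fieldType) (A : algType K) (a : K) (b : A) :
  GRing.in_alg A a * b = b * GRing.in_alg A a.
Proof. by rewrite /= -scalerAl mul1r -scalerAr mulr1. Qed.

Lemma tens_flip_rel (K : fieldType) (P Q : presentation K)
    (c := GRing.in_alg (tens Q P)) (g := fun p => ptens p.2 p.1 : tens Q P) :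
  forall s t : term K (palg P * palg Q), tens_rel s t -> teval c g s = teval c g t.
Proof.
move=> s t [] /= *; rewrite /g /c /= ?ptensPl ?ptensPr ?ptensM ?ptens1 //.
- by rewrite -scalerAl mul1r.
- by rewrite -scalerAl mul1r.
- by rewrite scale1r.
Qed.

Lemma tens_flipE (K : fieldType) (P Q : presentation K) (a : palg P) (b : palg Q) :
  tens_flip (ptens a b) = ptens b a.
Proof.
exact: (@plift_gen _ (tens_pres P Q) _ (GRing.in_alg (tens Q P)) _
  (@tens_flip_rel K P Q) (@in_algC _ (tens Q P)) (a, b)).
Qed.

Section TensorAction.
Variables (K : fieldType) (P Q : presentation K) (m n : nat).
Variables (rho : {lrmorphism palg P -> 'M[K]_m.+1}).
Variables (sigma : {lrmorphism palg Q -> 'M[K]_n.+1}).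
Local Notation act := (tens_act rho sigma).

Let scalM (a : K) (M : 'M[K]_(m.+1 * n.+1)) : a%:M * M = a *: M.
Proof. exact: mul_scalar_mx. Qed.

Lemma tens_act_rel (g := fun p => rho p.1 *t sigma p.2) :
  forall s t : term K (palg P * palg Q), tens_rel s t ->
    teval (@scalar_mx K (m.+1 * n.+1)) g s = teval (@scalar_mx K (m.+1 * n.+1)) g t.
Proof.
move=> s t [z a a' b|z a b b'|a a' b b'|] /=; rewrite /g /=.
- rewrite linearP; apply/matrixP=> i j.
  by rewrite scalM !mxE mulrDl mulrA.
- rewrite linearP; apply/matrixP=> i j.
  by rewrite scalM !mxE mulrDr mulrCA.
- by rewrite !rmorphM; exact: tensmx_mul.
- rewrite !rmorph1; apply/matrixP=> i j.
  case: (mxtens_indexP i) => i1 i2; case: (mxtens_indexP j) => j1 j2.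
  rewrite tensmxE !mxE -natrM mulnb; congr (nat_of_bool _)%:R.
  by rewrite (inj_eq (can_inj (@mxtens_indexK _ _))) xpair_eqE.
Qed.

Let cC (a : K) (M : 'M[K]_(m.+1 * n.+1)) : a%:M * M = M * a%:M.
Proof. exact: esym (scalar_mxC _ _). Qed.

Local Notation scal := (@scalar_mx K (m.+1 * n.+1)).

Lemma tens_actE a b : act (ptens a b) = rho a *t sigma b.
Proof. exact: (@plift_gen _ (tens_pres P Q) _ scal _ tens_act_rel cC (a, b)). Qed.
Lemma tens_actM x y : act (x * y) = act x *m act y.
Proof. exact: (@pliftM _ (tens_pres P Q) _ scal _ tens_act_rel cC). Qed.
Lemma tens_act1 : act 1 = 1%:M.
Proof. exact: (@plift1 _ (tens_pres P Q) _ scal _ tens_act_rel cC). Qed.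
Lemma tens_actP z x y : act (z *: x + y) = z *: act x + act y.
Proof.
have := @pliftP _ (tens_pres P Q) _ scal _ tens_act_rel cC z x y.
by rewrite /= scalM.
Qed.

End TensorAction.

(** * Root and weight lattices

   A connected complex semisimple group is given, up to isomorphism, by a
   Cartan matrix of finite type and a lattice [L] between the root lattice and
   the weight lattice. Elements of the rational span of the roots are row
   vectors of coordinates with respect to the simple roots, so that the root
   lattice consists of the vectors with integral coordinates. *)

Definition root_form (N : nat) (a : 'M[int]_N) (d : 'I_N -> nat)
    (x y : 'rV[rat]_N) : rat :=
  \sum_(i < N) \sum_(j < N) x 0 i * y 0 j * ((d i)%:R * (a i j)%:~R).

Record rootDatum := RootDatum {
  rank : nat;
  cartan : 'M[int]_rank;
  symm : 'I_rank -> nat;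
  charlat : zmodClosed 'rV[rat]_rank;
  cartan_diag : forall i, cartan i i = 2;
  cartan_offdiag : forall i j, i != j -> cartan i j <= 0;
  symm_gt0 : forall i, (0 < symm i)%N;
  cartan_symm : forall i j,
    (symm i)%:Z * cartan i j = (symm j)%:Z * cartan j i;
  cartan_posdef : forall x, x != 0 -> 0 < root_form cartan symm x x;
  charlat_root : forall i, delta_mx 0 i \in charlat;
  (* [2<x, alpha_i> / <alpha_i, alpha_i> = <x, alpha_i> / d_i] *)
  charlat_weight : forall x i, x \in charlat ->
    root_form cartan symm x (delta_mx 0 i) / (symm i)%:R \is a Num.int }.

Definition lat (X : rootDatum) := {x : 'rV[rat]_(rank X) | x \in charlat X}.
HB.instance Definition _ (X : rootDatum) := SubChoice.on (lat X).
HB.instance Definition _ (X : rootDatum) :=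
  [SubChoice_isSubZmodule of lat X by <:].

Definition simple_root (X : rootDatum) (i : 'I_(rank X)) : lat X :=
  exist _ (delta_mx 0 i) (charlat_root i).

Definition pairing (X : rootDatum) (x y : lat X) : rat :=
  root_form (cartan X) (@symm X) (val x) (val y).

Definition dominant (X : rootDatum) (x : lat X) : Prop :=
  forall i, 0 <= pairing x (simple_root i).

Definition posroot (X : rootDatum) (g : {ffun 'I_(rank X) -> nat}) : lat X :=
  \sum_i simple_root i *+ g i.

(** * Quantum parameter *)

(* [qroot] is the fixed root of [q], of order [qden]. *)
Record qparam (C : fieldType) (X : rootDatum) := QParam {
  qq : C;
  qden : nat;
  qroot : C;
  qq_neq0 : qq != 0;
  qq_not_root1 : forall n, (0 < n)%N -> qq ^+ n != 1;
  qden_gt0 : (0 < qden)%N;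
  qrootX : qroot ^+ qden = qq;
  qden_int : forall x y : lat X, qden%:R * pairing x y \is a Num.int }.

Section QuantumGroup.
Variables (C : fieldType) (X : rootDatum) (q : qparam C X).
Local Notation N := (rank X).
Local Notation L := (lat X).

(* [q^<x, y>] *)
Definition qpair (x y : L) : C := qroot q ^ numq ((qden q)%:R * pairing x y).

Definition qi (i : 'I_N) : C := qq q ^+ symm i.

Definition qint (t : C) (n : nat) : C := (t ^+ n - t ^- n) / (t - t^-1).
Definition qfact (t : C) (n : nat) : C := \prod_(1 <= k < n.+1) qint t k.
Definition qbin (t : C) (n k : nat) : C :=
  qfact t n / (qfact t k * qfact t (n - k)).

(** * The quantized enveloping algebra *)

Variant ugen := GenK of L | GenE of 'I_N | GenF of 'I_N.
Local Notation tK x := (TGen (GenK x)).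
Local Notation tE i := (TGen (GenE i)).
Local Notation tF i := (TGen (GenF i)).

(* [1 - a_ij], nonnegative for [i != j] *)
Definition serre_exp (i j : 'I_N) : nat := `|1 - cartan X i j|%N.

Definition serre (G : 'I_N -> ugen) (i j : 'I_N) : term C ugen :=
  let n := serre_exp i j in
  \big[@TAdd C ugen/TCst 0]_(r < n.+1)
    TScale ((-1) ^+ r * qbin (qi i) n r)
      (TMul (TMul (TExp (TGen (G i)) (n - r)) (TGen (G j))) (TExp (TGen (G i)) r)).

Inductive urel : term C ugen -> term C ugen -> Prop :=
| URelK0 : urel (tK 0) (TCst 1)
| URelKD x y : urel (TMul (tK x) (tK y)) (tK (x + y))
| URelKE x i : urel (TMul (TMul (tK x) (tE i)) (tK (- x)))
    (TScale (qpair x (simple_root i)) (tE i))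
| URelKF x i : urel (TMul (TMul (tK x) (tF i)) (tK (- x)))
    (TScale (qpair x (simple_root i))^-1 (tF i))
| URelEF i j : urel (TSub (TMul (tE i) (tF j)) (TMul (tF j) (tE i)))
    (if i == j then
       TScale (qi i - (qi i)^-1)^-1
         (TSub (tK (simple_root i)) (tK (- simple_root i)))
     else TCst 0)
| URelSerreE i j : i != j -> urel (serre GenE i j) (TCst 0)
| URelSerreF i j : i != j -> urel (serre GenF i j) (TCst 0).

Definition uaug (g : ugen) : C := if g is GenK _ then 1 else 0.

Fact uaugP s t : urel s t -> teval id uaug s = teval id uaug t.
Proof.
have serre0 G i j : (forall k, uaug (G k) = 0) -> teval id uaug (serre G i j) = 0.
  move=> G0; rewrite /serre; elim/big_rec: _ => //= r t' _ ->.
  by rewrite G0 mulr0 mul0r mulr0 addr0.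
case=> [|x y|x i|x i|i j|i j _|i j _] /=; rewrite ?(mulr0, mul0r, mulr1) //.
- by rewrite addr0; case: eqP => //= _; rewrite mulr1 subrr mulr0.
- exact: serre0.
- exact: serre0.
Qed.

Definition uq_pres : presentation C := Presentation uaugP.
Definition uq := palg uq_pres.
HB.instance Definition _ := GRing.Algebra.on uq.
Definition uq2 := tens uq_pres uq_pres.
HB.instance Definition _ := GRing.Algebra.on uq2.

Definition uK (x : L) : uq := pgenerator (P := uq_pres) (GenK x).
Definition uE (i : 'I_N) : uq := pgenerator (P := uq_pres) (GenE i).
Definition uF (i : 'I_N) : uq := pgenerator (P := uq_pres) (GenF i).
Local Notation Ki i := (uK (simple_root i)).
Local Notation Kinv i := (uK (- simple_root i)).

Definition utens (f g : uq) : uq2 := ptens f g.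
Local Notation "f '(x)' g" := (utens f g) (at level 40).

Record hopfStructure := HopfStructure {
  coproduct : {lrmorphism uq -> uq2};
  counit : {lrmorphism uq -> C^o};
  antipode : {linear uq -> uq};
  coproductK : forall x, coproduct (uK x) = uK x (x) uK x;
  coproductE : forall i, coproduct (uE i) = uE i (x) Ki i + 1 (x) uE i;
  coproductF : forall i, coproduct (uF i) = uF i (x) 1 + Kinv i (x) uF i;
  counitK : forall x, counit (uK x) = 1;
  counitE : forall i, counit (uE i) = 0;
  counitF : forall i, counit (uF i) = 0;
  antipodeM : forall f g, antipode (f * g) = antipode g * antipode f;
  antipodeK : forall x, antipode (uK x) = uK (- x);
  antipodeE : forall i, antipode (uE i) = - uE i * Kinv i;
  antipodeF : forall i, antipode (uF i) = - Ki i * uF i }.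

Inductive gen_subalg (G : 'I_N -> uq) : uq -> Prop :=
| GSGen i : gen_subalg G (G i)
| GSOne : gen_subalg G 1
| GSLin z f g : gen_subalg G f -> gen_subalg G g -> gen_subalg G (z *: f + g)
| GSMul f g : gen_subalg G f -> gen_subalg G g -> gen_subalg G (f * g).

Definition ad_weight (x : L) (f : uq) : Prop :=
  forall y, uK y * f * uK (- y) = qpair x y *: f.

Definition uq_nplus (x : L) (f : uq) : Prop := gen_subalg uE f /\ ad_weight x f.
Definition uq_nminus (x : L) (f : uq) : Prop := gen_subalg uF f /\ ad_weight x f.

(** * Irreducible highest weight representations *)

Definition irreducible_rep (n : nat) (rho : uq -> 'M[C]_n.+1) : Prop :=
  forall W : {vspace 'cV[C]_n.+1},
    (forall f w, w \in W -> rho f *m w \in W) -> W = 0%VS \/ W = fullv.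

Definition weight_vec (n : nat) (rho : uq -> 'M[C]_n.+1) (x : L) (v : 'cV[C]_n.+1)
  : Prop := forall y, rho (uK y) *m v = qpair y x *: v.

(* The finite-dimensional irreducible representation with dominant highest
   weight [x], acting on column vectors; its dual consists of row vectors. *)
Record irrep (x : L) := Irrep {
  idim : nat;
  irho : {lrmorphism uq -> 'M[C]_idim.+1};
  irho_irr : irreducible_rep irho;
  irho_dominant : dominant x;
  irho_hw : exists v, [/\ v != 0, weight_vec irho x v & forall i, irho (uE i) *m v = 0] }.

Definition vec x (V : irrep x) := 'cV[C]_(idim V).+1.
Definition covec x (V : irrep x) := 'rV[C]_(idim V).+1.

(* [u] has weight [y] in the dual representation [(f u)(v) = u(S(f) v)]. *)
Definition dual_weight_vec (H : hopfStructure) x (V : irrep x) (y : L)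
    (u : covec V) : Prop :=
  forall z, u *m irho V (antipode H (uK z)) = qpair z y *: u.

Definition matrix_coef x (V : irrep x) (u : covec V) (v : vec V) : uq -> C^o :=
  fun f => (u *m irho V f *m v) 0 0.

(** * The quantized coordinate algebra *)

Inductive in_Cq : (uq -> C^o) -> Prop :=
| CqCoef x (V : irrep x) (u : covec V) (v : vec V) : in_Cq (matrix_coef u v)
| CqZero : in_Cq 0
| CqLin z a b : in_Cq a -> in_Cq b -> in_Cq (z *: a + b).

Definition Cq_pred : {pred uq -> C^o} := fun a => `[< in_Cq a >].

Fact Cq_submod : submod_closed Cq_pred.
Proof.
split=> [|z a b /asboolP aP /asboolP bP]; apply/asboolP; first exact: CqZero.
exact: CqLin.
Qed.
HB.instance Definition _ := GRing.isSubmodClosed.Build C (uq -> C^o) Cq_pred Cq_submod.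

Definition Cq := {a : uq -> C^o | a \in Cq_pred}.
HB.instance Definition _ := SubChoice.on Cq.
HB.instance Definition _ := [SubChoice_isSubLmodule of Cq by <:].

Definition coef x (V : irrep x) (u : covec V) (v : vec V) : Cq :=
  exist _ (matrix_coef u v) (introT (asboolP _) (CqCoef u v)).

Definition as_functional (f : uq) : Cq -> C := fun a => val a f.

(* [s] lists the terms [a1 (x) a2] of an expression of the coproduct of [a],
   which is dual to the product of [uq]. *)
Definition Cq_coproduct (a : Cq) (s : seq (Cq * Cq)) : Prop :=
  forall f g, val a (f * g) = \sum_(p <- s) val p.1 f * val p.2 g.

Definition Cq_counit (a : Cq) : C := val a 1.

Definition bilinear_form (r : Cq -> Cq -> C) : Prop :=
  (forall a, scalar (r a : Cq -> C)) /\ (forall b, scalar (r^~ b : Cq -> C)).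

(** * The universal r-form *)

Definition act2 x (V : irrep x) y (W : irrep y) :
  uq2 -> 'M[C]_((idim V).+1 * (idim W).+1) := tens_act (irho V) (irho W).

(* A list of pure tensors summing to [t] witnesses membership in the tensor
   product of the two subspaces. *)
Definition in_tens (A B : uq -> Prop) (t : uq2) : Prop :=
  exists s : seq (uq * uq),
    (forall p, p \in s -> A p.1 /\ B p.2) /\ t = \sum_(p <- s) p.1 (x) p.2.

Definition is_D x (V : irrep x) y (W : irrep y)
    (D : 'M[C]_((idim V).+1 * (idim W).+1)) : Prop :=
  forall a b v w, weight_vec (irho V) a v -> weight_vec (irho W) b w ->
    D *m (v *t w) = qpair a b *: (v *t w).
Arguments is_D {x} V {y} W D.

(* Only finitely many [Theta g] act nontrivially, since [V] and [W] have
   finitely many weights. *)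
Definition theta_act (Theta : {ffun 'I_N -> nat} -> uq2)
    x (V : irrep x) y (W : irrep y) : 'M[C]_((idim V).+1 * (idim W).+1) :=
  (\sum_(g \in [set: {ffun 'I_N -> nat}]) act2 V W (Theta g))%R.

Record quasi_R_family (H : hopfStructure) (Theta : {ffun 'I_N -> nat} -> uq2) : Prop :=
  QuasiRFamily {
  theta0 : Theta [ffun=> 0%N] = 1 (x) 1;
  theta_deg : forall g, in_tens (uq_nplus (posroot g)) (uq_nminus (- posroot g))
                          (Theta g);
  theta_intertwine : forall x (V : irrep x) y (W : irrep y) D,
    is_D V W D -> forall f,
    (D *m theta_act Theta V W) *m act2 V W (coproduct H f) =
    act2 V W (tens_flip (coproduct H f)) *m (D *m theta_act Theta V W) }.

Definition universal_rform (Theta : {ffun 'I_N -> nat} -> uq2) (r : Cq -> Cq -> C) : Prop :=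
  bilinear_form r /\
  forall x (V : irrep x) y (W : irrep y) D, is_D V W D ->
    forall (u : covec V) (v : vec V) (u' : covec W) (v' : vec W),
    r (coef u v) (coef u' v') =
    ((u *t u') *m (D *m theta_act Theta V W) *m (v *t v')) 0 0.

(* [(r * r')(a (x) b) = r(a1 (x) b1) r'(a2 (x) b2)] in Sweedler notation. *)
Definition convolution_unit (r r' : Cq -> Cq -> C) : Prop :=
  forall a b s t, Cq_coproduct a s -> Cq_coproduct b t ->
    \sum_(p <- s) \sum_(p' <- t) r p.1 p'.1 * r' p.2 p'.2 =
    Cq_counit a * Cq_counit b.

Definition convolution_inverse (r rbar : Cq -> Cq -> C) : Prop :=
  [/\ bilinear_form rbar, convolution_unit r rbar & convolution_unit rbar r].

Definition l_plus (r : Cq -> Cq -> C) (a : Cq) : Cq -> C := fun b => r b a.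
Definition l_minus (rbar : Cq -> Cq -> C) (a : Cq) : Cq -> C := fun b => rbar a b.

End QuantumGroup.

(* Main.v *)
Require Import Defs.
From mathcomp Require Import all_boot all_order all_algebra.
From mathcomp Require Import boolp classical_sets reals complex.
From mathcomp Require Import fsbigop mxtens.
Import Order.TTheory GRing.Theory Num.Theory.
Local Open Scope ring_scope.

(** Write [R = D o Theta] with [Theta = sum_p a_p (x) b_p], where [a_p] has
   some weight [x] and [b_p] the weight [- x].  Since [u] has weight [mu],
   the diagonal part [D] acts on [u' (x) u] from the right as
   [K_mu] on the first leg ([diagonal_right]), so that
   [r(c_{u',v'} (x) c_{u,v}) = sum_p (u' K_mu a_p v') (u b_p v)].  The scalar
   [u b_p v] vanishes unless [mu = nu - x]; hence
   [l^+(c_{u,v}) = K_mu sum_p (u b_p v) a_p], where only the [a_p] of weight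
   [x = nu - mu] survive.  Moving [K_mu] to the right costs a scalar.

   For [l^-] one needs [R^-1 = Theta^-1 D^-1].  The vanishing of the products
   [u b_p v] comes from orthogonality of distinct weights, and so does the
   formula [D^-1 (v (x) v') = v (x) K_{-nu} v'].  If [Theta^-1] is again a sum
   [sum_p a_p (x) b_p] of tensors of opposite weights, then the same
   computation gives [l^-(c_{u,v}) = (sum_p (u a_p v) b_p) K_{-nu}], with only
   the [b_p] of weight [nu - mu] left.

   Two points need care.  First, [Theta] is an infinite sum.  The module [V]
   is spanned by weight vectors ([weight_basis]: their span is a nonzero
   submodule), so it has finitely many weights, and only the finitely many
   [Theta_gamma] with [gamma] a difference of two of them act on [V (x) W] or
   [W (x) V] ([theta_truncation]).  This finite set does not depend on [W], so
   one element [1 + T] of the tensor square of the algebra represents [Theta]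
   for every [W] at once; this is what makes [f^+] and [f^-] independent of
   the argument of the functional.  Secondly, the first legs of [T] have
   positive height, hence those of [T^K] act as zero on [V] for large [K], and
   the geometric series [sum_(i < K) (- T)^i] represents [Theta^-1], again
   uniformly in [W] ([theta_inverse_as_tensor]).

   The form [rbar], which is only known as a convolution inverse of [r], is
   identified with the matrix inverse of [R] in [rbar_coef]. *)

Set Implicit Arguments.
Unset Strict Implicit.
Unset Printing Implicit Defensive.

(** * The weight lattice and the characters of the torus *)

Section Lattice.
Context {C : fieldType} {X : rootDatum} (q : qparam C X).
Implicit Types x y z : lat X.

Lemma pairingDl x y z : pairing (x + y) z = pairing x z + pairing y z.
Proof.
rewrite /pairing /root_form -big_split; apply: eq_bigr => i _.
rewrite -big_split; apply: eq_bigr => j _.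
by rewrite [val (x + y)]raddfD mxE !mulrDl.
Qed.

Lemma pairingC x y : pairing x y = pairing y x.
Proof.
rewrite /pairing /root_form exchange_big; apply: eq_bigr => i _.
apply: eq_bigr => j _; rewrite [val x 0 j * _]mulrC; congr (_ * _).
have /(congr1 (intr : int -> rat)) := cartan_symm (r := X) j i.
by rewrite !intrM.
Qed.

Lemma pairingDr x y z : pairing z (x + y) = pairing z x + pairing z y.
Proof. by rewrite pairingC pairingDl !(pairingC z). Qed.

Lemma qrootU : qroot q \is a GRing.unit.
Proof.
rewrite unitfE; apply: contraNneq (qq_neq0 q) => q0.
by rewrite -(qrootX q) q0 expr0n gtn_eqF ?qden_gt0.
Qed.

Lemma qpairE {x y} {m : int} : (qden q)%:R * pairing x y = m%:~R ->
  qpair q x y = qroot q ^ m.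
Proof. by rewrite /qpair => ->; rewrite numq_int. Qed.

Lemma qden_pairing x y : {m : int | (qden q)%:R * pairing x y = m%:~R}.
Proof. by exists (numq ((qden q)%:R * pairing x y)); rewrite numqK ?qden_int. Qed.

Lemma qpair_neq0 x y : qpair q x y != 0.
Proof. by rewrite expfz_neq0 // -unitfE qrootU. Qed.

Lemma qpairC x y : qpair q x y = qpair q y x.
Proof. by rewrite /qpair pairingC. Qed.

Lemma qpairDr x y z : qpair q z (x + y) = qpair q z x * qpair q z y.
Proof.
have [[m Em] [n En]] := (qden_pairing z x, qden_pairing z y).
rewrite (qpairE Em) (qpairE En) -expfzDr -?unitfE ?qrootU //.
by apply: qpairE; rewrite pairingDr mulrDr Em En intrD.
Qed.

Lemma qpairDl x y z : qpair q (x + y) z = qpair q x z * qpair q y z.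
Proof. by rewrite !(qpairC _ z) qpairDr. Qed.

Lemma qpair0r z : qpair q z 0 = 1.
Proof.
by apply: (mulfI (qpair_neq0 z 0)); rewrite -qpairDr addr0 mulr1.
Qed.

Lemma qpair0l z : qpair q 0 z = 1.
Proof. by rewrite qpairC qpair0r. Qed.

Lemma qpairNr x z : qpair q z (- x) = (qpair q z x)^-1.
Proof.
apply: (mulfI (qpair_neq0 z x)).
by rewrite -qpairDr subrr qpair0r mulfV ?qpair_neq0.
Qed.

Lemma qpairNl x z : qpair q (- x) z = (qpair q x z)^-1.
Proof. by rewrite !(qpairC _ z) qpairNr. Qed.

Lemma qroot_expz_eq1 (m : int) : qroot q ^ m = 1 -> m = 0.
Proof.
move=> rm1; apply/eqP/negPn/negP => m0.
have {m0} n0 : (0 < `|m|)%N by rewrite absz_gt0.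
suff : qroot q ^+ `|m| = 1.
  move=> rn1; have := qq_not_root1 q n0.
  by rewrite -(qrootX q) exprAC rn1 expr1n eqxx.
by case: m rm1 {n0} => n //= /eqP; rewrite NegzE -exprnN invr_eq1 => /eqP.
Qed.

(** Distinct weights give distinct characters of the torus: [q^<z, x - y>] with
   [z = x - y] is a power of the root of [q] whose exponent is a nonzero
   multiple of the squared length of [z], and the form is positive definite. *)
Lemma qpair_inj x y : (forall z, qpair q z x = qpair q z y) -> x = y.
Proof.
move=> xy; apply/eqP; rewrite -subr_eq0; set z := x - y.
have [m Em] := qden_pairing z z.
have m0 : m = 0.
  apply: qroot_expz_eq1; rewrite -(qpairE Em) {2}/z qpairDr qpairNr xy.
  by rewrite mulfV ?qpair_neq0.
apply: contraT => z0.
have /(cartan_posdef (r := X)) : val z != 0.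
  by apply: contra z0 => /eqP z0; apply/eqP/val_inj; rewrite z0 raddf0.
move/eqP: Em; rewrite m0 mulf_eq0 pnatr_eq0 gtn_eqF ?qden_gt0 //= => /eqP.
by rewrite /pairing => ->; rewrite ltxx.
Qed.

End Lattice.

Section Height.
Context {X : rootDatum}.
Implicit Types (x : lat X) (g : {ffun 'I_(rank X) -> nat}).

(** The sum of the coordinates on the simple roots; it grades the Borel
   subalgebras and detects the nilpotency of the truncated [Theta - 1]. *)
Definition height x : rat := \sum_i val x 0 i.

Lemma heightD x y : height (x + y) = height x + height y.
Proof.
by rewrite /height -big_split; apply: eq_bigr => i _; rewrite raddfD mxE.
Qed.

Lemma val_posroot g i : val (posroot g) 0 i = (g i)%:R.
Proof.
rewrite /posroot raddf_sum summxE (eq_bigr (fun j => ((i == j) * g j)%:R)).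
  rewrite -natr_sum (bigD1 i) //= eqxx mul1n big1 ?addn0 // => j.
  by rewrite eq_sym => /negPf ->.
by move=> j _; rewrite raddfMn mulmxnE /= mxE natrM mulr_natr.
Qed.

Lemma posroot_inj : injective (@posroot X).
Proof.
move=> g h gh; apply/ffunP => i.
by apply/eqP; rewrite -(eqr_nat rat) -!val_posroot gh.
Qed.

Lemma height_posroot g : height (posroot g) = (\sum_i g i)%:R.
Proof. by rewrite /height natr_sum; apply: eq_bigr => i _; rewrite val_posroot. Qed.

Lemma height_posroot_ge1 g : g != [ffun=> 0%N] -> 1 <= height (posroot g).
Proof.
rewrite height_posroot ler1n lt0n; apply: contra => /eqP/esym/eqP.
rewrite eq_sym sum_nat_eq0 => /forallP g0.
by apply/eqP/ffunP => i; rewrite ffunE; apply/eqP/g0.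
Qed.

End Height.

(** * Weights in the quantized enveloping algebra and its modules *)

Section Weights.
Context {C : fieldType} {X : rootDatum} {q : qparam C X}.
Implicit Types (x y z : lat X) (f g : uq q).

Lemma uq_scaleAl (a : C) f g : a *: (f * g) = (a *: f : uq q) * g.
Proof. exact: scalerAl. Qed.

Lemma uq_scaleAr (a : C) f g : a *: (f * g) = f * (a *: g : uq q).
Proof. exact: scalerAr. Qed.

Lemma uK0 : uK q 0 = 1.
Proof.
by have /pclassP := peq_rel (URelK0 q : prel (p := uq_pres q) _ _).
Qed.

Lemma uKD x y : uK q (x + y) = uK q x * uK q y.
Proof.
have /pclassP := peq_rel (URelKD q x y : prel (p := uq_pres q) _ _).
by rewrite -pmulE; apply: esym.
Qed.

Lemma uKN x : uK q (- x) * uK q x = 1.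
Proof. by rewrite -uKD addNr uK0. Qed.

Lemma uE_weight i : ad_weight (simple_root i) (uE q i).
Proof.
move=> y; have /pclassP := peq_rel (URelKE q y i : prel (p := uq_pres q) _ _).
by rewrite -pscaleE -!pmulE qpairC.
Qed.

Lemma uF_weight i : ad_weight (- simple_root i) (uF q i).
Proof.
move=> y; have /pclassP := peq_rel (URelKF q y i : prel (p := uq_pres q) _ _).
by rewrite -pscaleE -!pmulE qpairNl qpairC.
Qed.

Lemma ad_weight_comm x f y : ad_weight x f -> uK q y * f = qpair q x y *: (f * uK q y).
Proof. by move=> fx; rewrite uq_scaleAl -fx -mulrA uKN mulr1. Qed.

Lemma ad_weight1 : ad_weight 0 (1 : uq q).
Proof. by move=> y; rewrite mulr1 -uKD subrr uK0 qpair0l scale1r. Qed.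

Lemma ad_weightM x y f g : ad_weight x f -> ad_weight y g -> ad_weight (x + y) (f * g).
Proof.
move=> fx gy z; rewrite mulrA (ad_weight_comm _ fx) -uq_scaleAl -uq_scaleAl.
by rewrite -2!mulrA (mulrA _ g) gy -uq_scaleAr scalerA -qpairDl.
Qed.

(** The coefficients are allowed to kill the terms of other weights: this is the
   way in which [f^+] and [f^-] become homogeneous. *)
Lemma ad_weight_sum {I : eqType} (s : seq I) (a : I -> C) (F : I -> uq q) x :
    (forall i, i \in s -> a i = 0 \/ ad_weight x (F i)) ->
  ad_weight x (\sum_(i <- s) a i *: F i).
Proof.
move=> Fx y; rewrite mulr_sumr mulr_suml scaler_sumr.
rewrite big_seq [RHS]big_seq; apply: eq_bigr => i /Fx[-> | Fi].
  by rewrite scale0r mulr0 mul0r scaler0.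
by rewrite -uq_scaleAr -uq_scaleAl Fi scalerA mulrC -scalerA.
Qed.

Lemma gen_subalg0 (G : 'I_(rank X) -> uq q) : gen_subalg G 0.
Proof.
by have := GSLin (-1) (GSOne G) (GSOne G); rewrite scaleN1r addNr.
Qed.

Lemma gen_subalg_sum (G : 'I_(rank X) -> uq q) {I : eqType} (s : seq I)
    (a : I -> C) (F : I -> uq q) :
    (forall i, i \in s -> gen_subalg G (F i)) ->
  gen_subalg G (\sum_(i <- s) a i *: F i).
Proof.
elim: s => [|i s IHs] Gs; first by rewrite big_nil; apply: gen_subalg0.
rewrite big_cons; apply: GSLin; first by apply: Gs; rewrite mem_head.
by apply: IHs => j js; apply: Gs; rewrite inE js orbT.
Qed.

Lemma uq_ind (Q : uq q -> Prop) :
    (forall x, Q (uK q x)) -> (forall i, Q (uE q i)) -> (forall i, Q (uF q i)) ->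
    (forall a : C, Q a%:A) -> (forall f g, Q f -> Q g -> Q (f + g)) ->
    (forall f g, Q f -> Q g -> Q (f * g)) -> forall f, Q f.
Proof.
move=> QK QE QF QA QD QM; elim/pclassW => t; rewrite pclassE.
elim: t => [[x|i|i]|a|s IHs t IHt|s IHs t IHt] /=; first exact: QK.
- exact: QE.
- exact: QF.
- exact: QA.
- exact: QD.
- exact: QM.
Qed.

End Weights.

Section WeightSpaces.
Context {C : fieldType} {X : rootDatum} {q : qparam C X} {n : nat}.
Variable rho : {lrmorphism uq q -> 'M[C]_n.+1}.
Implicit Types (x y z : lat X) (f g : uq q) (v : 'cV[C]_n.+1) (u : 'rV[C]_n.+1).

(** On row vectors the algebra acts from the right, without the antipode; such a
   [u] has weight [- x] in the dual representation. *)
Definition left_weight_vec x u := forall z, u *m rho (uK q z) = qpair q z x *: u.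

Lemma rhoM f g : rho (f * g) = rho f *m rho g.
Proof. by rewrite rmorphM. Qed.

Lemma rho_sum I (s : seq I) (a : I -> C) (F : I -> uq q) :
  rho (\sum_(i <- s) a i *: F i) = \sum_(i <- s) a i *: rho (F i).
Proof. by rewrite linear_sum; apply: eq_bigr => i _; rewrite linearZ. Qed.

Lemma weight_vec_act x y f v : ad_weight x f -> weight_vec rho y v ->
  weight_vec rho (x + y) (rho f *m v).
Proof.
move=> fx vy z; rewrite mulmxA -rhoM (ad_weight_comm _ fx) linearZ /= rhoM.
by rewrite -scalemxAl -mulmxA vy -scalemxAr scalerA qpairDr (qpairC _ x).
Qed.

Lemma left_weight_orth x y u v : left_weight_vec x u -> weight_vec rho y v ->
  x <> y -> u *m v = 0.
Proof.
move=> ux vy xy; apply/eqP; apply/negPn/negP => uv0.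
apply: xy; apply: (qpair_inj (q := q)) => z.
have : (qpair q z x - qpair q z y) *: (u *m v) = 0.
  by rewrite scalerBl scalemxAl -ux -mulmxA vy -scalemxAr subrr.
by move/eqP; rewrite scaler_eq0 (negPf uv0) orbF subr_eq0 => /eqP.
Qed.

Lemma left_weight_act x y z f u v : ad_weight x f -> weight_vec rho y v ->
  left_weight_vec z u -> z <> x + y -> u *m rho f *m v = 0.
Proof.
move=> fx vy uz zxy; rewrite -mulmxA.
exact: left_weight_orth uz (weight_vec_act fx vy) zxy.
Qed.

End WeightSpaces.

Section WeightBasis.
Context {C : fieldType} {X : rootDatum} {q : qparam C X} {lambda : lat X}.
Variable V : irrep q lambda.

(** A maximal free family of weight vectors spans every weight vector.  Its span
   is stable under all generators, since these map weight vectors to weight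
   vectors, and contains the highest weight vector; irreducibility makes it the
   whole module. *)
Lemma weight_spanning : exists s : seq (vec V),
  [/\ free s, <<s>>%VS = fullv & forall v, v \in s -> exists x, weight_vec (irho V) x v].
Proof.
pose wv (v : vec V) := `[< exists x, weight_vec (irho V) x v >].
pose P k := `[< exists s : seq (vec V), [/\ size s = k, free s & all wv s] >].
have exP : exists k, P k.
  by exists 0%N; apply/asboolP; exists [::]; split=> //; apply: nil_free.
have maxP k : P k -> (k <= \dim {:vec V})%N.
  by case/asboolP=> s [<- + _]; rewrite /free => /eqP <-; rewrite dimvS ?subvf.
case: (ex_maxnP exP maxP) => m /asboolP[s [ss fs ws]] maxm.
have inW v x : weight_vec (irho V) x v -> v \in <<s>>%VS.
  move=> vx; apply/negPn/negP => vs.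
  suff /maxm : P m.+1 by rewrite ltnn.
  apply/asboolP; exists (v :: s); rewrite /= ss free_cons vs fs ws; split=> //.
  by rewrite andbT; apply/asboolP; exists x.
have invG f : (forall v x, weight_vec (irho V) x v ->
      exists y, weight_vec (irho V) y (irho V f *m v)) ->
    forall w, w \in <<s>>%VS -> irho V f *m w \in <<s>>%VS.
  move=> wf w /(coord_span (X := in_tuple s)) ->.
  rewrite mulmx_sumr; apply: memv_suml => i _; rewrite -scalemxAr memvZ //.
  have /(allP ws)/asboolP[x /wf[y]] : (in_tuple s)`_i \in s by exact: mem_nth.
  exact: inW.
have inv f : forall w, w \in <<s>>%VS -> irho V f *m w \in <<s>>%VS.
  elim/(@uq_ind C X q): f => [x|i|i|a|f g IHf IHg|f g IHf IHg].
  - apply: invG => v y vy; exists y => z; rewrite mulmxA -!rhoM -uKD.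
    by rewrite addrC uKD rhoM -mulmxA vy -scalemxAr.
  - by apply: invG => v x vx; eexists; apply: weight_vec_act vx; apply: uE_weight.
  - by apply: invG => v x vx; eexists; apply: weight_vec_act vx; apply: uF_weight.
  - by move=> w ws'; rewrite linearZ /= rmorph1 -scalemxAl mul1mx memvZ.
  - by move=> w ws'; rewrite raddfD /= mulmxDl memvD ?IHf ?IHg.
  - by move=> w ws'; rewrite rhoM -mulmxA IHf ?IHg.
exists s; split=> //; last by move=> v /(allP ws)/asboolP.
case: (irho_irr inv) => // s0.
case: (irho_hw V) => v [/negP v0 /inW vs _].
by case: v0; rewrite -memv0 -s0.
Qed.

(** The rows [c j] are the basis dual to the weight vectors [b j], so the last
   identity resolves the identity matrix into projections onto weight lines. *)
Lemma weight_basis : exists m (b : 'I_m -> vec V) (c : 'I_m -> covec V)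
    (wt : 'I_m -> lat X),
  [/\ forall j, weight_vec (irho V) (wt j) (b j),
      forall j, left_weight_vec (irho V) (wt j) (c j) &
      \sum_j b j *m c j = 1%:M].
Proof.
have [s [fs sV ws]] := weight_spanning.
pose S := in_tuple s; pose b (j : 'I_(size s)) : vec V := S`_j.
have /choice[wt bwt] j : exists x, weight_vec (irho V) x (b j).
  by apply: ws; apply: mem_nth.
pose c (j : 'I_(size s)) : covec V := \row_k coord S j (delta_mx k 0).
have cE j (v : vec V) : c j *m v = (coord S j v)%:M.
  apply/matrixP => k l; rewrite !ord1 !mxE eqxx mulr1n [in RHS](matrix_sum_delta v).
  rewrite linear_sum; apply: eq_bigr => i _ /=.
  by rewrite big_ord1 linearZ /= mxE mulrC.
have bc : \sum_j b j *m c j = 1%:M.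
  apply/trmx_inj/row_matrixP => k; rewrite -!tr_col !colE mul1mx.
  set v := delta_mx k 0 : vec V; congr trmx; rewrite mulmx_suml.
  rewrite [RHS](coord_span (X := S)) ?sV ?memvf //.
  by apply: eq_bigr => j _; rewrite -mulmxA cE mul_mx_scalar.
exists (size s), b, c, wt; split=> // j z.
rewrite -[LHS]mulmx1 -bc mulmx_sumr -[in RHS](mulmx1 (c j)) -bc mulmx_sumr.
rewrite scaler_sumr; apply: eq_bigr => k _.
rewrite 2!mulmxA -(mulmxA (c j)) bwt -scalemxAr -scalemxAl cE.
have [-> //|jk] := eqVneq k j.
by rewrite coord_free // (negPf jk) raddf0 mul0mx !scaler0.
Qed.

End WeightBasis.

(** * Kronecker products *)

Section TensorMatrices.
Context {C : fieldType}.

Lemma tensmxDl m n p r (A A' : 'M[C]_(m, n)) (B : 'M[C]_(p, r)) :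
  (A + A') *t B = A *t B + A' *t B.
Proof. by apply/matrixP => i j; rewrite !mxE mulrDl. Qed.

Lemma tensmxDr m n p r (A : 'M[C]_(m, n)) (B B' : 'M[C]_(p, r)) :
  A *t (B + B') = A *t B + A *t B'.
Proof. by apply/matrixP => i j; rewrite !mxE mulrDr. Qed.

Lemma tensmxZl m n p r (z : C) (A : 'M[C]_(m, n)) (B : 'M[C]_(p, r)) :
  (z *: A) *t B = z *: (A *t B).
Proof. by apply/matrixP => i j; rewrite !mxE mulrA. Qed.

Lemma tensmxZr m n p r (z : C) (A : 'M[C]_(m, n)) (B : 'M[C]_(p, r)) :
  A *t (z *: B) = z *: (A *t B).
Proof. by apply/matrixP => i j; rewrite !mxE mulrCA. Qed.

Lemma tensmx_suml I (s : seq I) m n p r (A : I -> 'M[C]_(m, n)) (B : 'M[C]_(p, r)) :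
  (\sum_(i <- s) A i) *t B = \sum_(i <- s) A i *t B.
Proof.
elim: s => [|i s IHs]; first by rewrite !big_nil tens0mx.
by rewrite !big_cons tensmxDl IHs.
Qed.

Lemma tensmx_sumr I (s : seq I) m n p r (A : 'M[C]_(m, n)) (B : I -> 'M[C]_(p, r)) :
  A *t (\sum_(i <- s) B i) = \sum_(i <- s) A *t B i.
Proof.
elim: s => [|i s IHs]; first by rewrite !big_nil tensmx0.
by rewrite !big_cons tensmxDr IHs.
Qed.

Lemma tensmx11 (A B : 'M[C]_1) : (A *t B : 'M_(1 * 1)) 0 0 = A 0 0 * B 0 0.
Proof. by rewrite mxE !ord1. Qed.

Lemma tens_delta_mx m n (k : 'I_m) (l : 'I_n) :
  (delta_mx k 0 : 'cV[C]_m) *t (delta_mx l 0 : 'cV[C]_n) =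
  delta_mx (mxtens_index (k, l)) (0 : 'I_(1 * 1)).
Proof.
apply/matrixP => i j; case: (mxtens_indexP i) => a b.
rewrite (ord1 j) !mxE mxtens_indexK !ord1 !eqxx !andbT /= -natrM mulnb.
by rewrite (inj_eq (can_inj (@mxtens_indexK _ _))) xpair_eqE.
Qed.

Lemma tens_row_ext m n (A B : 'M[C]_(1 * 1, m * n)) :
    (forall (y : 'cV_m) (y' : 'cV_n), (A *m (y *t y')) 0 0 = (B *m (y *t y')) 0 0) ->
  A = B.
Proof.
move=> AB; apply/matrixP => i j; rewrite (ord1 i).
case: (mxtens_indexP j) => k l.
have := AB (delta_mx k 0) (delta_mx l 0).
by rewrite tens_delta_mx -!colE !mxE.
Qed.

End TensorMatrices.

(** * Tensors with legs of opposite weights *)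

Section GradedTensors.
Context {C : fieldType} {X : rootDatum} {q : qparam C X}.
Implicit Types (x y z : lat X) (f g : uq q) (s t : uq2 q).

(** Homogeneity of the two legs in opposite degrees is what the triangular
   formulas need; the lower bound [k] on the height of these degrees adds up
   under products and so forces high powers to act as zero. *)
Definition graded_tens (k : nat) t := exists ps : seq (uq q * uq q),
  (forall p, p \in ps ->
     exists x, [/\ k%:R <= height x, uq_nplus x p.1 & uq_nminus (- x) p.2]) /\
  t = \sum_(p <- ps) utens p.1 p.2.

Lemma utensZl (z : C) f g : utens (z *: f) g = z *: utens f g.
Proof.
have e0 : utens (0 : uq q) g = 0.
  have := ptensPl (P := uq_pres q) (Q := uq_pres q) (-1) 1 1 g.
  by rewrite !scaleN1r !addNr.
have := ptensPl (P := uq_pres q) (Q := uq_pres q) z f 0 g.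
by rewrite addr0 [ptens 0 g]e0 addr0.
Qed.

Lemma graded_tensD k s t : graded_tens k s -> graded_tens k t -> graded_tens k (s + t).
Proof.
move=> [ps [psP ->]] [qs [qsP ->]]; exists (ps ++ qs); split; last by rewrite big_cat.
by move=> p; rewrite mem_cat => /orP[/psP|/qsP].
Qed.

Lemma graded_tens0 k : graded_tens k 0.
Proof. by exists [::]; rewrite big_nil. Qed.

Lemma graded_tensN k t : graded_tens k t -> graded_tens k (- t).
Proof.
move=> [ps [psP ->]]; exists [seq (-1 *: p.1 : uq q, p.2) | p <- ps]; split.
  move=> _ /mapP[p /psP[x [kx [p1 p1x] p2]] ->]; exists x; split=> //=; split.
    by have := GSLin (-1) p1 (gen_subalg0 _); rewrite addr0.
  by have := ad_weight_sum (s := [:: p.1]) (a := fun=> -1) (F := id) (x := x);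
     rewrite big_seq1; apply=> f; rewrite inE => /eqP ->; right.
rewrite big_map -sumrN; apply: eq_bigr => p _ /=.
by rewrite utensZl scaleN1r.
Qed.

Lemma graded_tens_sum k I (r : seq I) (P : pred I) (F : I -> uq2 q) :
  (forall i, P i -> graded_tens k (F i)) -> graded_tens k (\sum_(i <- r | P i) F i).
Proof.
move=> FP; elim/big_rec: _ => [|i t Pi]; first exact: graded_tens0.
by apply: graded_tensD; apply: FP.
Qed.

Lemma graded_tens1 : graded_tens 0 1.
Proof.
exists [:: (1, 1)]; rewrite big_seq1 [utens _ _]ptens1; split=> // p.
rewrite inE => /eqP ->; exists 0; split=> /=.
- by rewrite /height big1 // => i _; rewrite raddf0 mxE.
- by split; [apply: GSOne | apply: ad_weight1].
- by rewrite oppr0; split; [apply: GSOne | apply: ad_weight1].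
Qed.

Lemma graded_tensM k l s t :
  graded_tens k s -> graded_tens l t -> graded_tens (k + l) (s * t).
Proof.
move=> [ps [psP ->]] [qs [qsP ->]].
exists [seq (p.1 * r.1, p.2 * r.2) | p <- ps, r <- qs]; split.
  move=> _ /allpairsP[[p r] [/= /psP[x [kx [p1 p1x] [p2 p2x]]] + ->]].
  move=> /qsP[y [ly [r1 r1y] [r2 r2y]]]; exists (x + y); split => /=.
  - by rewrite heightD natrD lerD.
  - by split; [apply: GSMul | apply: ad_weightM].
  - by rewrite opprD; split; [apply: GSMul | apply: ad_weightM].
rewrite big_allpairs_dep mulr_suml; apply: eq_bigr => p _.
by rewrite mulr_sumr; apply: eq_bigr => r _; exact: ptensM.
Qed.

Lemma graded_tensX k t : graded_tens 1 t -> graded_tens k (t ^+ k).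
Proof.
move=> gt; elim: k => [|k IHk]; first by rewrite expr0; apply: graded_tens1.
by rewrite exprS -add1n; apply: graded_tensM.
Qed.

Lemma graded_tensW k t : graded_tens k t -> graded_tens 0 t.
Proof.
move=> [ps [psP ->]]; exists ps; split=> // p /psP[x [kx p1 p2]].
by exists x; split=> //; apply: le_trans kx.
Qed.

Lemma graded_tens_theta (g : {ffun 'I_(rank X) -> nat}) t :
    in_tens (uq_nplus (posroot g)) (uq_nminus (- posroot g)) t ->
    g != [ffun=> 0%N] ->
  graded_tens 1 t.
Proof.
move=> [ps [psP ->]] g0; exists ps; split=> // p /psP[p1 p2].
by exists (posroot g); split=> //; apply: height_posroot_ge1.
Qed.

End GradedTensors.

Section TensorActions.
Context {C : fieldType} {X : rootDatum} {q : qparam C X} {lam lam' : lat X}.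
Variables (V : irrep q lam) (W : irrep q lam').
Implicit Types (s t : uq2 q).

Lemma act2D s t : act2 V W (s + t) = act2 V W s + act2 V W t.
Proof. by have := tens_actP (irho V) (irho W) 1 s t; rewrite !scale1r. Qed.

Lemma act20 : act2 V W 0 = 0.
Proof. by apply: (addrI (act2 V W 0)); rewrite -act2D !addr0. Qed.

Lemma act2_sum I (r : seq I) (P : pred I) (F : I -> uq2 q) :
  act2 V W (\sum_(i <- r | P i) F i) = \sum_(i <- r | P i) act2 V W (F i).
Proof. exact: (big_morph _ act2D act20). Qed.

Lemma act2M s t : act2 V W (s * t) = act2 V W s *m act2 V W t.
Proof. exact: tens_actM. Qed.

Lemma act21 : act2 V W 1 = 1%:M.
Proof. exact: tens_act1. Qed.

Lemma act2_utens (f g : uq q) : act2 V W (utens f g) = irho V f *t irho W g.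
Proof. exact: tens_actE. Qed.

Lemma act2_coef (ps : seq (uq q * uq q)) (u : covec V) (u' : covec W)
    (v : vec V) (v' : vec W) :
  ((u *t u') *m act2 V W (\sum_(p <- ps) utens p.1 p.2) *m (v *t v')) 0 0 =
  \sum_(p <- ps) (u *m irho V p.1 *m v) 0 0 * (u' *m irho W p.2 *m v') 0 0.
Proof.
rewrite act2_sum mulmx_sumr mulmx_suml summxE; apply: eq_bigr => p _.
by rewrite act2_utens !tensmx_mul tensmx11.
Qed.

End TensorActions.

(** * Truncating [Theta] and inverting it *)

Section WeightFiniteness.
Context {C : fieldType} {X : rootDatum} {q : qparam C X} {lambda : lat X}.
Variable V : irrep q lambda.
Implicit Types (x y : lat X) (f : uq q).

(** An element of weight [x] sends the weight space of [wt j] to that of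
   [x + wt j], which is zero unless this is one of the weights [wt i]. *)
Lemma weight_differences : exists m (wt : 'I_m -> lat X), forall x f,
  ad_weight x f -> (forall i j, x <> wt i - wt j) -> irho V f = 0.
Proof.
have [m [b [c [wt [bwt cwt bc]]]]] := weight_basis V.
exists m, wt => x f fx nx.
rewrite -[LHS]mul1mx -bc mulmx_suml big1 // => i _.
rewrite -[LHS]mulmx1 -bc mulmx_sumr big1 // => j _.
rewrite mulmxA -(mulmxA (b i)) -(mulmxA (b i)).
rewrite (left_weight_act fx (bwt j) (cwt i)) ?mulmx0 ?mul0mx // => e.
by apply: (nx i j); rewrite e addrK.
Qed.

Lemma act_high : exists K : nat, forall x f,
  ad_weight x f -> K%:R <= height x -> irho V f = 0.
Proof.
have [m [wt wtP]] := weight_differences.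
pose h i j := height (wt i - wt j).
exists (\max_(p : 'I_m * 'I_m) Num.bound `|h p.1 p.2|) => x f fx Kx.
apply: (wtP _ _ fx) => i j xE; move: Kx; rewrite xE leNgt => /negP; apply.
apply: (le_lt_trans (ler_norm _)); apply: lt_le_trans (archi_boundP _) _ => //.
rewrite ler_nat.
exact: (leq_bigmax (F := fun p : 'I_m * 'I_m => Num.bound `|h p.1 p.2|) (i, j)).
Qed.

Lemma act_posroot_finite : exists S : seq {ffun 'I_(rank X) -> nat},
  uniq S /\ forall g f, g \notin S ->
    ad_weight (posroot g) f \/ ad_weight (- posroot g) f -> irho V f = 0.
Proof.
have [m [wt wtP]] := weight_differences.
pose G (p : 'I_m * 'I_m) : {ffun 'I_(rank X) -> nat} :=
  xget [ffun=> 0%N] [set g | posroot g = wt p.1 - wt p.2].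
exists (undup [seq G p | p : 'I_m * 'I_m]); rewrite undup_uniq; split=> // g f.
rewrite mem_undup => /negP gS.
have ng i j : posroot g <> wt i - wt j.
  move=> gE; apply: gS; apply/mapP; exists (i, j); first by rewrite mem_enum.
  apply: posroot_inj; rewrite gE /G.
  by case: xgetP => [h _ -> //|/(_ g)].
case=> fg; apply: (wtP _ _ fg) => i j //; move/(congr1 -%R).
by rewrite opprK opprB; apply: ng.
Qed.

End WeightFiniteness.

Section Theta.
Context {C : fieldType} {X : rootDatum} {q : qparam C X} (H : hopfStructure q).
Context {Theta : {ffun 'I_(rank X) -> nat} -> uq2 q}.
Hypothesis hTheta : quasi_R_family H Theta.
Context {lambda : lat X}.
Variable V : irrep q lambda.

(** The same [T] serves every [W] and both orders of the factors, because the
   components of [Theta] that are left out act as zero already on [V]: their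
   two legs have opposite weights, of which neither is a difference of weights
   of [V]. *)
Lemma theta_truncation : exists T : uq2 q, graded_tens 1 T /\
  forall lam' (W : irrep q lam'),
    theta_act Theta V W = act2 V W (1 + T) /\ theta_act Theta W V = act2 W V (1 + T).
Proof.
have [S [uS SP]] := act_posroot_finite V.
pose g0 : {ffun 'I_(rank X) -> nat} := [ffun=> 0%N].
(* The degree 0 is put into the support by hand, as the summand 1 of Theta. *)
pose S' := undup (g0 :: S).
have S'P g : g \notin S' -> g \notin S.
  by rewrite mem_undup inE negb_or => /andP[].
have TE : 1 + \sum_(g <- S' | g != g0) Theta g = \sum_(g <- S') Theta g.
  rewrite [RHS](bigD1_seq g0) ?undup_uniq ?mem_undup ?mem_head //=.
  by rewrite (theta0 hTheta) [utens 1 1]ptens1.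
exists (\sum_(g <- S' | g != g0) Theta g); split.
  apply: graded_tens_sum => g g_neq0.
  exact: graded_tens_theta (theta_deg hTheta g) g_neq0.
move=> lam' W; rewrite TE; split; rewrite /theta_act (fsbigE S') ?undup_uniq //.
- by rewrite act2_sum; apply: eq_bigl => g; rewrite in_setT.
- move=> g _ /S'P gS; have [ps [psP ->]] := theta_deg hTheta g.
  rewrite act2_sum big_seq big1 // => p /psP[[_ p1] _].
  by rewrite act2_utens (SP _ _ gS) ?tens0mx; [|left].
- by rewrite act2_sum; apply: eq_bigl => g; rewrite in_setT.
- move=> g _ /S'P gS; have [ps [psP ->]] := theta_deg hTheta g.
  rewrite act2_sum big_seq big1 // => p /psP[_ [_ p2]].
  by rewrite act2_utens [irho V _](SP _ _ gS) ?tensmx0; [|right].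
Qed.

Lemma theta_as_tensor : exists t : uq2 q, graded_tens 0 t /\
  forall lam' (W : irrep q lam'), theta_act Theta W V = act2 W V t.
Proof.
have [T [T1 TE]] := theta_truncation.
exists (1 + T); split; last by move=> lam' W; have [] := TE _ W.
by apply: graded_tensD graded_tens1 (graded_tensW T1).
Qed.

(** With [Theta = 1 + T], the finite geometric series in [- T] is an inverse up
   to [(- T) ^+ K], whose first legs have height at least [K] and vanish on [V]
   once [K] exceeds every difference of heights of weights of [V]. *)
Lemma theta_inverse_as_tensor : exists t : uq2 q, graded_tens 0 t /\
  forall lam' (W : irrep q lam'), theta_act Theta V W *m act2 V W t = 1%:M.
Proof.
have [T [T1 TE]] := theta_truncation; have [K KP] := act_high V.
exists (\sum_(i < K) (- T) ^+ i); split.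
  apply: graded_tens_sum => i _; apply: (@graded_tensW _ _ _ i).
  exact/graded_tensX/graded_tensN.
move=> lam' W; have [-> _] := TE _ W; rewrite -act2M -[T in 1 + T]opprK.
have -> : (1 - - T) * \sum_(i < K) (- T) ^+ i = 1 + - (- T) ^+ K.
  by rewrite -opprB mulNr -subrX1 opprB.
rewrite act2D act21.
have /graded_tensN[ps [psP ->]] : graded_tens K ((- T) ^+ K).
  exact/graded_tensX/graded_tensN.
rewrite act2_sum big_seq big1 ?addr0 // => p /psP[x [Kx [_ p1] _]].
by rewrite act2_utens (KP _ _ p1 Kx) tens0mx.
Qed.

End Theta.

(** * The diagonal part of the R-matrix *)

Section DiagonalPart.
Context {C : fieldType} {X : rootDatum} {q : qparam C X} {lambda : lat X}.
Variable V : irrep q lambda.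

(** The witness decomposes the factor [V] into weight lines and lets the [K] of
   the corresponding weight act on [W], so that nothing has to be known about
   the weights of [W]. *)
Lemma diagonal_right lam' (W : irrep q lam') :
  exists D : 'M[C]_((idim W).+1 * (idim V).+1), is_D (V := W) (W := V) D /\
    forall mu (u : covec V) (u' : covec W), left_weight_vec (irho V) mu u ->
      (u' *t u) *m D = (u' *m irho W (uK q mu)) *t u.
Proof.
have [m [b [c [wt [bwt cwt bc]]]]] := weight_basis V.
exists (\sum_j irho W (uK q (wt j)) *t (b j *m c j)); split.
  move=> x y w v wx vy; rewrite mulmx_suml -[v in RHS]mul1mx -bc mulmx_suml.
  rewrite tensmx_sumr scaler_sumr; apply: eq_bigr => j _.
  rewrite tensmx_mul wx tensmxZl -mulmxA.
  have [-> | /eqP jy] := eqVneq (wt j) y; first by rewrite qpairC.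
  by rewrite (left_weight_orth (cwt j) vy jy) mulmx0 tensmx0 !scaler0.
move=> mu u u' uw; rewrite mulmx_sumr -[u in RHS]mulmx1 -bc mulmx_sumr.
rewrite tensmx_sumr; apply: eq_bigr => j _; rewrite tensmx_mul mulmxA.
have [-> // | /eqP/nesym jm] := eqVneq (wt j) mu.
by rewrite (left_weight_orth uw (bwt j) jm) mul0mx !tensmx0.
Qed.

Lemma diagonal_left lam' (W : irrep q lam') :
  exists D : 'M[C]_((idim V).+1 * (idim W).+1), is_D (V := V) (W := W) D /\
    forall nu (v : vec V) (w : vec W), weight_vec (irho V) nu v ->
      D *m (v *t w) = v *t (irho W (uK q nu) *m w).
Proof.
have [m [b [c [wt [bwt cwt bc]]]]] := weight_basis V.
pose D := \sum_j (b j *m c j) *t irho W (uK q (wt j)).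
have DE nu (v : vec V) (w : vec W) : weight_vec (irho V) nu v ->
    D *m (v *t w) = v *t (irho W (uK q nu) *m w).
  move=> vn; rewrite mulmx_suml -[v in RHS]mul1mx -bc mulmx_suml.
  rewrite tensmx_suml; apply: eq_bigr => j _; rewrite tensmx_mul -mulmxA.
  have [-> // | /eqP jn] := eqVneq (wt j) nu.
  by rewrite (left_weight_orth (cwt j) vn jn) mulmx0 !tens0mx.
by exists D; split=> // x y v w vx wy; rewrite (DE x) // wy tensmxZr.
Qed.

End DiagonalPart.

(** * Matrix coefficients *)

Section CoordinateAlgebra.
Context {C : fieldType} {X : rootDatum} {q : qparam C X}.

Lemma Cq_scalar_ext (phi : Cq q -> C) (f : uq q) : scalar phi ->
    (forall lam (W : irrep q lam) (u : covec W) (v : vec W),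
      phi (coef u v) = (u *m irho W f *m v) 0 0) ->
  phi = as_functional f.
Proof.
move=> phiL phiE; apply: funext => -[a Ha]; rewrite /as_functional /=.
have /asboolP aP := Ha.
elim: aP Ha => {a} [x V u v|| z a b aP IHa bP IHb] Ha.
- by rewrite -[RHS]phiE; congr phi; apply: val_inj.
- have := phiL (-1) 0 0; rewrite scaleN1r addNr mulN1r addNr.
  by apply: etrans; congr phi; apply: val_inj.
- have [a' b'] := (introT (asboolP _) aP, introT (asboolP _) bP).
  rewrite -[RHS]/(z * a f + b f) -(IHa a') -(IHb b') -phiL.
  by congr phi; apply: val_inj.
Qed.

Lemma scalar_sum (phi : Cq q -> C) : scalar phi -> forall I (s : seq I) (z : I -> C) a,
  phi (\sum_(i <- s) z i *: a i) = \sum_(i <- s) z i * phi (a i).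
Proof.
move=> phiL I s z a; elim: s => [|i s IHs]; last by rewrite !big_cons phiL IHs.
rewrite !big_nil; have := phiL (-1) 0 0.
by rewrite scaleN1r addNr mulN1r addNr.
Qed.

Lemma as_functional_scalar (f : uq q) : scalar (@as_functional C X q f).
Proof. by []. Qed.

Context {lam : lat X} (V : irrep q lam).

Lemma coef_sumr (u : covec V) (v : vec V) :
  coef u v = \sum_k v k 0 *: coef u (delta_mx k 0).
Proof.
apply: val_inj; apply: funext => f.
rewrite [RHS](scalar_sum (as_functional_scalar f)) /as_functional /=.
rewrite /matrix_coef [in LHS]mxE; apply: eq_bigr => k _ /=.
by rewrite /matrix_coef -colE [X in _ = _ * X]mxE mulrC.
Qed.

(** Insertion of the identity matrix, as the sum of the elementary matrices,
   between the actions of the two factors. *)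
Lemma coef_coproduct (u : covec V) (v : vec V) :
  Cq_coproduct (coef u v)
    [seq (coef u (delta_mx k 0), coef (delta_mx 0 k) v) | k : 'I_(idim V).+1].
Proof.
move=> f g; rewrite /= big_map big_enum /= /matrix_coef.
rewrite rhoM mulmxA -mulmxA mxE; apply: eq_bigr => k _.
by rewrite -colE -[_ *m v in RHS]mulmxA -rowE !mxE.
Qed.

End CoordinateAlgebra.

(** * The l-functionals *)

Section ConvolutionInverse.
Context {C : fieldType} {X : rootDatum} {q : qparam C X}.
Context {Theta : {ffun 'I_(rank X) -> nat} -> uq2 q} {r rbar : Cq q -> Cq q -> C}.
Hypothesis hr : universal_rform Theta r.
Hypothesis hrbar : convolution_inverse r rbar.

(** The values of [rbar] on the coefficients with left covectors [u], [u'] form a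
   row vector [Phi] on [V (x) W].  The identity [rbar * r = 1], evaluated by
   [coef_coproduct], says that [Phi R = u (x) u']; applying this to [z] with
   [R z = v (x) v'] gives the value of [rbar] without any inverse matrix. *)
Lemma rbar_coef lam lam' (V : irrep q lam) (W : irrep q lam')
    (D : 'M[C]_((idim V).+1 * (idim W).+1)) :
    is_D (V := V) (W := W) D ->
  forall (u : covec V) (v : vec V) (u' : covec W) (v' : vec W) z,
    D *m theta_act Theta V W *m z = v *t v' ->
  rbar (coef u v) (coef u' v') = ((u *t u') *m z) 0 0.
Proof.
move=> hD u v u' v' z zE.
have [[rbarr rbarl] _ rbarK] := hrbar.
pose w k l := rbar (coef u (delta_mx k 0)) (coef u' (delta_mx l 0)).
pose Phi := \sum_k \sum_l
  w k l *: ((delta_mx 0 k : covec V) *t (delta_mx 0 l : covec W)).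
have PhiE (y : vec V) (y' : vec W) : (Phi *m (y *t y')) 0 0 = rbar (coef u y) (coef u' y').
  rewrite (coef_sumr u y) (scalar_sum (rbarl _)).
  rewrite mulmx_suml summxE; apply: eq_bigr => k _.
  rewrite (coef_sumr u' y') (scalar_sum (rbarr _)).
  rewrite mulmx_suml summxE mulr_sumr; apply: eq_bigr => l _.
  rewrite -scalemxAl mxE tensmx_mul tensmx11 -!rowE !mxE.
  by rewrite mulrC -mulrA.
have PhiM : Phi *m (D *m theta_act Theta V W) = u *t u'.
  apply: tens_row_ext => y y'.
  have := rbarK _ _ _ _ (coef_coproduct u y) (coef_coproduct u' y').
  rewrite big_map big_enum /= tensmx_mul tensmx11 /Cq_counit /= /matrix_coef.
  rewrite !rmorph1 !mulmx1 => <-.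
  rewrite !mulmx_suml summxE; apply: eq_bigr => k _.
  rewrite big_map big_enum /= !mulmx_suml summxE; apply: eq_bigr => l _.
  by rewrite -!scalemxAl mxE (proj2 hr _ _ _ _ _ hD).
by rewrite -PhiE -zE mulmxA PhiM.
Qed.

End ConvolutionInverse.

Section LFunctionals.
Context {C : fieldType} {X : rootDatum} {q : qparam C X} (H : hopfStructure q).
Context {Theta : {ffun 'I_(rank X) -> nat} -> uq2 q}.
Hypothesis hTheta : quasi_R_family H Theta.
Context {r rbar : Cq q -> Cq q -> C}.
Hypothesis hr : universal_rform Theta r.
Hypothesis hrbar : convolution_inverse r rbar.
Context {lambda : lat X} (V : irrep q lambda).
Implicit Types (mu nu : lat X) (u : covec V) (v : vec V).

(** The antipode turns [K_z] into [K_{-z}], which cancels the sign of the weight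
   in the dual representation. *)
Lemma dual_weight_left mu u :
  dual_weight_vec H (- mu) u -> left_weight_vec (irho V) mu u.
Proof.
move=> hu z; have := hu (- z); rewrite antipodeK opprK => ->.
by rewrite qpairNr qpairNl invrK.
Qed.

(** The element found directly is [K_mu f] with [f] of weight [nu - mu]; the
   scalar [c] is the price of moving [K_mu] to the right of [f]. *)
Lemma l_plus_triangular mu nu u v :
    left_weight_vec (irho V) mu u -> weight_vec (irho V) nu v ->
  exists f, uq_nplus (nu - mu) f /\
    l_plus r (coef u v) = as_functional (f * uK q mu).
Proof.
move=> hu hv; have [t [[ps [psP tE]] thetaE]] := theta_as_tensor hTheta V.
pose a (p : uq q * uq q) := (u *m irho V p.2 *m v) 0 0.
pose f : uq q := \sum_(p <- ps) a p *: p.1.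
have fw : ad_weight (nu - mu) f.
  apply: ad_weight_sum => p /psP[x [_ [_ p1] [_ p2]]].
  have [xE|/eqP mux] := eqVneq mu (- x + nu).
    by right; rewrite xE opprD opprK addrCA subrr addr0.
  by left; rewrite /a (left_weight_act p2 hv hu mux) mxE.
have fn : gen_subalg (uE q) f.
  by apply: gen_subalg_sum => p /psP[x [_ [p1 _] _]].
pose c := qpair q (nu - mu) mu.
exists (c *: f); split.
  split; first by have := GSLin c fn (gen_subalg0 _); rewrite addr0.
  have := ad_weight_sum (s := [:: f]) (a := fun=> c) (F := id) (x := nu - mu).
  by rewrite big_seq1; apply=> g; rewrite inE => /eqP ->; right.
rewrite -uq_scaleAl -(ad_weight_comm _ fw).
apply: Cq_scalar_ext; first exact: (proj2 (proj1 hr)).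
move=> lam' W u' v'; have [D [hD DE]] := diagonal_right V W.
rewrite /l_plus (proj2 hr _ _ _ _ _ hD) mulmxA (DE mu) // thetaE tE act2_coef.
rewrite rhoM rho_sum mulmx_sumr mulmx_sumr mulmx_suml summxE.
apply: eq_bigr => p _; rewrite -scalemxAr -scalemxAr -scalemxAl [RHS]mxE.
by rewrite mulrC mulmxA.
Qed.

(** The vector [Theta^-1 (v (x) K_{-nu} v')] is a preimage of [v (x) v'] under
   [R], because the diagonal part acts on [v (x) w] by [K_nu] on [w]. *)
Lemma l_minus_triangular mu nu u v :
    left_weight_vec (irho V) mu u -> weight_vec (irho V) nu v ->
  exists f, uq_nminus (nu - mu) f /\
    l_minus rbar (coef u v) = as_functional (f * uK q (- nu)).
Proof.
move=> hu hv; have [t [[ps [psP tE]] thetaK]] := theta_inverse_as_tensor hTheta V.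
pose a (p : uq q * uq q) := (u *m irho V p.1 *m v) 0 0.
exists (\sum_(p <- ps) a p *: p.2); split.
  split; first by apply: gen_subalg_sum => p /psP[x [_ _ [p2 _]]].
  apply: ad_weight_sum => p /psP[x [_ [_ p1] [_ p2]]].
  have [->|/eqP mux] := eqVneq mu (x + nu).
    by right; rewrite opprD addrCA subrr addr0.
  by left; rewrite /a (left_weight_act p1 hv hu mux) mxE.
apply: Cq_scalar_ext; first by have [[]] := hrbar.
move=> lam' W u' v'; have [D [hD DE]] := diagonal_left V W.
have zE : D *m theta_act Theta V W *m
    (act2 V W t *m (v *t (irho W (uK q (- nu)) *m v'))) = v *t v'.
  rewrite mulmxA -(mulmxA D) thetaK mulmx1 (DE nu) // mulmxA -rhoM -uKD.
  by rewrite subrr uK0 rmorph1 mul1mx.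
rewrite /l_minus (rbar_coef hr hrbar hD _ _ zE).
rewrite mulmxA tE act2_coef rhoM rho_sum mulmx_suml mulmx_sumr mulmx_suml summxE.
apply: eq_bigr => p _.
by rewrite -!scalemxAl -scalemxAr -scalemxAl [RHS]mxE !mulmxA.
Qed.

End LFunctionals.

Unset Implicit Arguments.

Theorem proposition3 (R : realType) (X : rootDatum) (q : qparam R[i] X)
    (H : hopfStructure q)
    (Theta : {ffun 'I_(rank X) -> nat} -> uq2 q)
    (hTheta : quasi_R_family H Theta)
    (r rbar : Cq q -> Cq q -> R[i])
    (hr : universal_rform Theta r)
    (hrbar : convolution_inverse r rbar)
    (lambda mu nu : lat X) (V : irrep q lambda) (u : covec V) (v : vec V)
    (hu : dual_weight_vec H (- mu) u)
    (hv : weight_vec (irho V) nu v) :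
  (exists fplus : uq q, uq_nplus (nu - mu) fplus /\
     l_plus r (coef u v) = as_functional (fplus * uK q mu)) /\
  (exists fminus : uq q, uq_nminus (nu - mu) fminus /\
     l_minus rbar (coef u v) = as_functional (fminus * uK q (- nu))).
Proof.
have hu' := dual_weight_left hu.
split; first exact (l_plus_triangular hTheta hr hu' hv).
exact (l_minus_triangular hTheta hr hrbar hu' hv).
Qed.
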